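(* For $n\geq 1$, let $F(n)$ denote the number of forests on $[n]$ that avoid each of the patterns $213$, $312$, $231$, and set $F(0)=1$. Then for all $n\ge 1$, $$F(n)=\sum_{k=1}^n\sum_{r=1}^k\binom{n-1}{k-1}(r-1)!\,F(n-k)\,F(k-r),$$ and $F(1)=1$.
   Context: A forest on $[n]$ is an unordered rooted forest whose $n$ vertices are labeled bijectively by $[n]$. A forest avoids a pattern $\sigma$ if for every vertex $v$, the sequence of labels along the path from the root of the tree containing $v$ down to $v$ contains no subsequence in the same relative order as $\sigma$. *)

(* Defs.v *)
From mathcomp Require Import all_boot.

Set Implicit Arguments.
Unset Strict Implicit.
Unset Printing Implicit Defensive.

(* An unordered rooted forest labeled by [n] is encoded by its parent map:    *)
(* [p v = None] when [v] is a root, [p v = Some u] when [u] is the parent of  *)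
(* [v].  The label set {1, ..., n} is represented by ['I_n] = {0, ..., n-1}   *)
(* with its order; only the relative order of labels matters here.            *)
Definition parent_map (n : nat) := {ffun 'I_n -> option 'I_n}.

Definition child_of (n : nat) (p : parent_map n) : rel 'I_n :=
  fun v u => p v == Some u.

(* No directed cycle: no vertex is reachable from its own parent. *)
Definition is_forest (n : nat) (p : parent_map n) : bool :=
  [forall v, forall u, child_of p v u ==> ~~ connect (child_of p) u v].

(* The vertices on the path from the root down to [v]; in a forest on [n],    *)
(* the chain of ancestors starting at [v] has at most [n] elements.           *)
Definition root_path (n : nat) (p : parent_map n) (v : 'I_n) : seq 'I_n :=
  rev (pmap id (traject (obind p) (Some v) n)).

Lemma root_path_fuel (n : nat) (p : parent_map n) (k : nat) (v r : 'I_n)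
    (s : seq 'I_n) :
  p r = None -> path (fun x y => child_of p y x) r s -> last r s = v ->
  size s < k -> rev (pmap id (traject (obind p) (Some v) k)) = r :: s.
Proof.
move=> pr; elim/last_ind: s v k => [|s y IHs] v [|k] //=.
  move=> _ <- _; rewrite pr.
  suff ->: pmap id (traject (obind p) None k) = [::] by [].
  by elim: k => //= k.
rewrite rcons_path last_rcons size_rcons ltnS => /andP[ps /eqP py] <- lt_sk.
by rewrite py rev_cons (IHs _ _ ps erefl lt_sk).
Qed.

Lemma forest_path_uniq (n : nat) (p : parent_map n) (r : 'I_n) (s : seq 'I_n) :
  is_forest p -> path (fun x y => child_of p y x) r s -> uniq (r :: s).
Proof.
move=> /forallP Fp ps.
pose e x y := [exists z, child_of p y z && connect (child_of p) z x].
apply: (@sorted_uniq _ e); last 1 first.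
- apply: sub_path ps => x y pyx; apply/existsP; exists x.
  by rewrite pyx connect0.
- move=> y x z /existsP[a /andP[pya cax]] /existsP[b /andP[pzb cby]].
  apply/existsP; exists b; rewrite pzb (connect_trans cby) //.
  exact: connect_trans (connect1 pya) cax.
- move=> x; apply: negbTE; apply/existsP => -[z /andP[pxz czx]].
  by move: (Fp x) => /forallP/(_ z); rewrite pxz czx.
Qed.

Lemma forest_rooted (n : nat) (p : parent_map n) (v : 'I_n) :
  is_forest p ->
  exists r s,
    [/\ p r = None, path (fun x y => child_of p y x) r s & last r s = v].
Proof.
move=> Fp.
have [m] := ubnP #|connect (child_of p) v|.
elim: m v => // m IHm v; rewrite ltnS => le_m.
case pv: (p v) => [u|]; last by exists v, [::].
have pvu : child_of p v u by apply/eqP.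
have [|r [s [pr ps ls]]] := IHm u.
  apply: leq_trans le_m; apply: proper_card; apply/properP; split.
    by apply/subsetP => x; apply: connect_trans (connect1 pvu).
  exists v; first exact: connect0.
  by move: Fp => /forallP/(_ v)/forallP/(_ u); rewrite pvu.
by exists r, (rcons s v); rewrite rcons_path ps last_rcons ls.
Qed.

(* In a forest, [root_path p v] is the unique sequence that starts at a root, *)
(* goes from parent to child at each step, and ends at [v].                   *)
Lemma root_pathP (n : nat) (p : parent_map n) (v r : 'I_n) (s : seq 'I_n) :
  is_forest p ->
  (root_path p v = r :: s) <->
  [/\ p r = None, path (fun x y => child_of p y x) r s & last r s = v].
Proof.
move=> Fp.
have main r' s' : p r' = None -> path (fun x y => child_of p y x) r' s' ->
    last r' s' = v -> root_path p v = r' :: s'.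
  move=> pr ps ls; apply: root_path_fuel => //.
  have /card_uniqP /= <- := forest_path_uniq Fp ps.
  by rewrite -[X in _ <= X](card_ord n) max_card.
split=> [rp|[]]; last exact: main.
have [r' [s' [pr ps ls]]] := forest_rooted v Fp.
by move: (main _ _ pr ps ls); rewrite rp => -[-> ->].
Qed.

Definition label_seq (n : nat) (p : parent_map n) (v : 'I_n) : seq nat :=
  [seq val u | u <- root_path p v].

Definition same_relative_order (s t : seq nat) : bool :=
  (size s == size t) &&
  [forall i : 'I_(size s), forall j : 'I_(size s),
    (nth 0 s i < nth 0 s j) == (nth 0 t i < nth 0 t j)].

(* Subsequences of [s] are the [mask m s]. *)
Definition contains_pattern (sigma s : seq nat) : bool :=
  [exists m : (size s).-tuple bool, same_relative_order (mask m s) sigma].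

Definition forest_avoids (n : nat) (p : parent_map n) (sigma : seq nat) : bool :=
  [forall v, ~~ contains_pattern sigma (label_seq p v)].

Definition avoiding_forests (n : nat) (sigmas : seq (seq nat)) :
    {set parent_map n} :=
  [set p : parent_map n | is_forest p & all (forest_avoids p) sigmas].

Definition F (n : nat) : nat :=
  if n == 0 then 1
  else #|avoiding_forests n [:: [:: 2; 1; 3]; [:: 3; 1; 2]; [:: 2; 3; 1]]|.

(* Main.v *)
(* Fix a vertex [a] and let [B] be the set of labels of its tree and [r] the  *)
(* root of that tree.  By avoidance of 213, 312 and 231, a path from [r]      *)
(* whose first step goes to a smaller label keeps decreasing, and one whose   *)
(* first step goes to a larger label stays above [r].  Hence the labels of    *)
(* [B] below [r] hang from [r] as a decreasing tree, for which each label     *)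
(* chooses its parent freely among the larger ones, the labels of [B] above   *)
(* [r] form an arbitrary avoiding forest hung from [r], and the labels        *)
(* outside [B] form another one.                                              *)
(* Working with forests supported on an arbitrary set of labels, one obtains  *)
(* by induction that their number only depends on its size, so that no        *)
(* relabelling is ever needed.                                                *)

Require Import Defs.
From mathcomp Require Import all_boot.
From mathcomp Require Import zify.

Set Implicit Arguments.
Unset Strict Implicit.
Unset Printing Implicit Defensive.

(** Once a label [a] is fixed, the double sum classifies the forests by the size k of the tree of
    [a] and the rank r of the root inside that tree. The other labels of the tree can be chosen in
    C(n-1,k-1) ways. Among the r-1 labels below the root, one with j larger ones has j+1 possible
    parents (the root included), so these labels contribute (r-1)! ([card_decreasing]). The k-r
    labels above the root and the n-k labels outside the tree carry independent avoiding forests.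
    [glue] assembles the three pieces; [glue_in], [glue_inj] and [glue_onto] make it a bijection
    onto the forests with a given tree and root ([card_fiber]). Summing the fibers gives
    [card_forests_on_step], whose pieces have fewer labels, and [card_forests_on] evaluates these by
    [F]. [F_forests_on] connects the count to pattern avoidance. *)

(** * Ancestors, and avoidance expressed on chains of ancestors *)

Section Ancestors.
Variable n : nat.
Implicit Types (p q : parent_map n) (u v w x : 'I_n) (A B : {set 'I_n}).

(* [u] is a proper ancestor of [v]. *)
Definition anc p v u :=
  [exists w, child_of p v w && connect (child_of p) w u].

Lemma ancP p v u :
  reflect (exists2 w, p v = Some w & connect (child_of p) w u) (anc p v u).
Proof.
apply: (iffP existsP) => [[w /andP[/eqP pv wu]]|[w pv wu]]; exists w => //.
by rewrite /child_of pv eqxx.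
Qed.

Lemma is_forestP p : reflect (forall v, ~~ anc p v v) (is_forest p).
Proof.
apply: (iffP forallP) => [Fp v|Fp v].
  apply/ancP => -[w pv wv]; move/forallP/(_ w): (Fp v).
  by rewrite /child_of pv eqxx wv.
apply/forallP => u; apply/implyP => /eqP pv; apply: contra (Fp v) => uv.
by apply/ancP; exists u.
Qed.

Lemma connect_anc p v u : connect (child_of p) v u = (v == u) || anc p v u.
Proof.
apply/idP/orP => [/connectP[[_ ->|w s /= /andP[/eqP pv ps] ->]]|].
- by left.
- by right; apply/ancP; exists w => //; apply/connectP; exists s.
case=> [/eqP-> //|/ancP[w pv]].
by apply: connect_trans; apply/connect1/eqP.
Qed.

Lemma anc_ind p (P : 'I_n -> 'I_n -> Prop) :
  (forall v u, p v = Some u -> P v u) ->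
  (forall v u w, p v = Some u -> anc p u w -> P u w -> P v w) ->
  forall v u, anc p v u -> P v u.
Proof.
move=> P1 PS v u /ancP[w pv /connectP[s]].
elim: s v w pv => [|x s IHs] v w pv /=; first by move=> _ ->; apply: P1.
move=> /andP[/eqP pw ps] lu; apply: (PS v w) => //; last exact: IHs pw ps lu.
by apply/ancP; exists x => //; apply/connectP; exists s.
Qed.

Lemma anc_trans p : transitive (anc p).
Proof.
move=> u v w /ancP[x px xu] uw; apply/ancP; exists x => //.
by apply: connect_trans xu _; rewrite connect_anc uw orbT.
Qed.

Lemma sub_anc p q v u :
  (forall x y, p x = Some y -> q x = Some y) -> anc p v u -> anc q v u.
Proof.
move=> sub_pq; elim/anc_ind => {v u} [v u /sub_pq qv|v u w /sub_pq qv _ uw].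
  by apply/ancP; exists u => //; apply: connect0.
by apply/ancP; exists u; rewrite // connect_anc uw orbT.
Qed.

Lemma connect_stable p (X : {pred 'I_n}) x y :
  (forall v u, p v = Some u -> v \in X -> u \in X) ->
  connect (child_of p) x y -> x \in X -> y \in X.
Proof.
move=> clX /connectP[s ps ->]; elim: s x ps => //= z s IHs x.
move=> /andP[/eqP pz ps] xX.
exact: IHs ps (clX _ _ pz xX).
Qed.

Lemma forest_root p v :
  is_forest p -> exists2 r, connect (child_of p) v r & p r = None.
Proof.
move=> Fp; have [r [s [pr ps <-]]] := forest_rooted v Fp; exists r => //.
elim/last_ind: s ps => [|s x IHs]; first by rewrite connect0.
rewrite rcons_path last_rcons => /andP[/IHs sr sx].
exact: connect_trans (connect1 sx) sr.
Qed.

(* [w], [u], [v] is a chain from the root downwards: the first disjunct is a  *)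
(* valley (213 or 312), the second one is 231.                                *)
Definition bad_chain w u v := ((u < w) && (u < v)) || ((v < w) && (w < u)).

Definition chains_avoid p :=
  [forall v, forall u, forall w, anc p v u && anc p u w ==> ~~ bad_chain w u v].

Lemma chains_avoidP p :
  reflect (forall v u w, anc p v u -> anc p u w -> ~~ bad_chain w u v)
          (chains_avoid p).
Proof.
apply: (iffP forallP) => [Hp v u w vu uw|Hp v].
  by move: (Hp v) => /forallP/(_ u)/forallP/(_ w); rewrite vu uw.
by apply/forallP=> u; apply/forallP=> w; apply/implyP=> /andP[]; apply: Hp.
Qed.

Definition supported A p :=
  [forall v, forall u, (p v == Some u) ==> (v \in A) && (u \in A)].

Lemma supportedP A p :
  reflect (forall v u, p v = Some u -> v \in A /\ u \in A) (supported A p).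
Proof.
apply: (iffP forallP) => [Hp v u pv|Hp v].
  by move: (Hp v) => /forallP/(_ u); rewrite pv eqxx => /andP.
by apply/forallP=> u; apply/implyP=> /eqP/Hp[-> ->].
Qed.

(** Labels outside [A] have neither parent nor child: they stay in the type as isolated roots.
    Forests on all label subsets thus share the type [parent_map n]. *)
Definition forests_on A : {set parent_map n} :=
  [set p | [&& is_forest p, supported A p & chains_avoid p]].

Lemma forests_onP A p :
  reflect [/\ forall v, ~~ anc p v v,
              forall v u, p v = Some u -> v \in A /\ u \in A &
              forall v u w, anc p v u -> anc p u w -> ~~ bad_chain w u v]
          (p \in forests_on A).
Proof.
rewrite inE; apply: (iffP and3P) => -[].
  by move=> /is_forestP ? /supportedP ? /chains_avoidP.
by move=> /is_forestP ? /supportedP ? /chains_avoidP.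
Qed.

(** Deleting edges only removes ancestor pairs, so acyclicity and avoidance are inherited. *)
Lemma sub_forests_on A B p q :
  (forall x y, p x = Some y -> q x = Some y) ->
  (forall x y, p x = Some y -> x \in A /\ y \in A) ->
  q \in forests_on B -> p \in forests_on A.
Proof.
move=> sub_pq sub_A /forests_onP[Fq _ Cq]; apply/forests_onP; split=> //.
  by move=> v; apply: contra (Fq v); apply: sub_anc.
by move=> v u w /(sub_anc sub_pq) vu /(sub_anc sub_pq); apply: Cq.
Qed.

Lemma forests_on0 : #|forests_on set0| = 1.
Proof.
rewrite (_ : forests_on set0 = [set [ffun=> None]]) ?cards1 //.
apply/setP => p; rewrite !inE; apply/and3P/eqP => [[_ /supportedP Hp _]|->].
  apply/ffunP=> x; rewrite ffunE; case px: (p x) => [y|//].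
  by have [] := Hp _ _ px; rewrite inE.
have noanc v u : anc [ffun=> None] v u = false.
  by apply/negbTE/ancP => -[w]; rewrite ffunE.
split; first by apply/is_forestP=> v; rewrite noanc.
  by apply/supportedP => v u; rewrite ffunE.
by apply/chains_avoidP => v u w; rewrite noanc.
Qed.

End Ancestors.

(** * From patterns in root paths to chains of ancestors *)

Lemma root_path_anc n (p : parent_map n) v u w :
  is_forest p -> anc p v u -> anc p u w -> subseq [:: w; u; v] (root_path p v).
Proof.
move=> Fp vu uw.
have desc x y : anc p x y ->
    exists2 s, path (fun x y => child_of p y x) y s & last y s = x /\ x \in s.
  elim/anc_ind => {x y} [x y px|x y z px _ [s ps [ls _]]].
    by exists [:: x]; rewrite /= ?inE ?eqxx ?andbT //; apply/eqP.
  exists (rcons s x); last by rewrite last_rcons mem_rcons inE eqxx.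
  by rewrite rcons_path ps ls; apply/eqP.
have [r [s [pr ps ls]]] := forest_rooted w Fp.
have [s1 ps1 [ls1 us1]] := desc _ _ uw.
have [s2 ps2 [ls2 vs2]] := desc _ _ vu.
(* By uniqueness of the root path, it is the concatenation of the descents from a root to [w], from
   [w] to [u] and from [u] to [v]. *)
have /(root_pathP _ _ _ Fp)-> :
    [/\ p r = None, path (fun x y => child_of p y x) r (s ++ s1 ++ s2) &
        last r (s ++ s1 ++ s2) = v].
  by rewrite !cat_path !last_cat ls ls1 ps ps1 ps2.
rewrite -cat_cons -[[:: w; u; v]]/([:: w] ++ [:: u] ++ [:: v]).
by rewrite !cat_subseq ?sub1seq // -ls mem_last.
Qed.

Lemma root_path_sorted n (p : parent_map n) v :
  is_forest p -> sorted (fun x y => anc p y x) (root_path p v).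
Proof.
move=> Fp; have [r [s rs]] := forest_rooted v Fp.
have /(root_pathP _ _ _ Fp)-> := rs; case: rs => _ ps _ /=.
apply: sub_path ps => x y /eqP yx.
by apply/ancP; exists x => //; apply: connect0.
Qed.

Lemma same_relative_order3 (a b c x y z : nat) :
  same_relative_order [:: a; b; c] [:: x; y; z] =
  all (fun e => (e.1.1 < e.2.1) == (e.1.2 < e.2.2))
    [seq (e1, e2) | e1 <- [:: (a, x); (b, y); (c, z)],
                    e2 <- [:: (a, x); (b, y); (c, z)]].
Proof.
rewrite /same_relative_order eqxx /=; apply/forallP/idP => [H|].
  have h i j (i3 : i < 3) (j3 : j < 3) := forallP (H (Ordinal i3)) (Ordinal j3).
  do !(apply/andP; split=> //).
  - exact: (h 0 0).
  - exact: (h 0 1).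
  - exact: (h 0 2).
  - exact: (h 1 0).
  - exact: (h 1 1).
  - exact: (h 1 2).
  - exact: (h 2 0).
  - exact: (h 2 1).
  - exact: (h 2 2).
case/andP=> h00 /andP[h01 /andP[h02 /andP[h10 /andP[h11]]]].
case/andP=> h12 /andP[h20 /andP[h21 /andP[h22 _]]].
by case=> [[|[|[|//]]] ?]; apply/forallP => -[[|[|[|//]]] ?].
Qed.

Lemma forest_avoids3 n (p : parent_map n) x y z : is_forest p ->
  reflect (forall v u w, anc p v u -> anc p u w ->
             ~~ same_relative_order [:: val w; val u; val v] [:: x; y; z])
          (forest_avoids p [:: x; y; z]).
Proof.
move=> Fp; apply: (iffP forallP) => [Av v u w vu uw|Av v].
  apply: contra (Av v) => so.
  have /(map_subseq val)/subseqP[m sz_m def_s] := root_path_anc Fp vu uw.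
  rewrite -/(label_seq p v) in sz_m def_s.
  apply/existsP; have sz : size m == size (label_seq p v) by apply/eqP.
  by exists (Tuple sz); rewrite /= -def_s.
apply/existsP => -[m]; rewrite /label_seq -map_mask => so.
(* The root path is sorted for a transitive relation, so successive entries of an occurrence are
   still in the ancestor relation. *)
have := subseq_sorted _ (mask_subseq m _) (root_path_sorted v Fp).
move=> /(_ (fun b a c ab bc => anc_trans bc ab)).
have /eqP := proj1 (andP so); rewrite size_map.
case: (mask _ _) so => [|w [|u [|t []]]] //= so _ /and3P[wu ut _].
by move: (Av _ _ _ ut wu); rewrite so.
Qed.

Lemma F_forests_on n : F n = #|forests_on [set: 'I_n]|.
Proof.
rewrite /F; case: eqP => [->|_].
  suff -> : [set: 'I_0] = set0 by rewrite forests_on0.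
  by apply/setP => -[].
apply: eq_card => p; rewrite !inE; case Fp: (is_forest p) => //=.
have -> : supported setT p by apply/supportedP => v u _; rewrite !inE.
rewrite /= !andbT; apply/and3P/chains_avoidP.
  case=> /(forest_avoids3 _ _ _ Fp) A1 /(forest_avoids3 _ _ _ Fp) A2.
  move=> /(forest_avoids3 _ _ _ Fp) A3 v u w vu uw.
  move: (A1 _ _ _ vu uw) (A2 _ _ _ vu uw) (A3 _ _ _ vu uw).
  rewrite !same_relative_order3 /= /bad_chain.
  (* A valley is an occurrence of 213 or 312 only if its two ends differ; acyclicity ensures
     this. *)
  have : (v != w :> nat).
    apply/eqP => /val_inj vw; rewrite -vw in uw.
    by move/is_forestP/(_ v): Fp; rewrite (anc_trans vu uw).
  move: (v : nat) (u : nat) (w : nat) => /= a b c.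
  by case: (ltngtP c b); case: (ltngtP b a); case: (ltngtP a c); lia.
move=> H; split; apply/(forest_avoids3 _ _ _ Fp) => v u w vu uw;
  move: (H _ _ _ vu uw); rewrite same_relative_order3 /= /bad_chain;
  clear; move: (v : nat) (u : nat) (w : nat) => a b c;
  by case: (ltngtP c b); case: (ltngtP b a); case: (ltngtP a c); lia.
Qed.

(** * Cutting a forest along the tree of a fixed label *)

Section Decomposition.
Variables (n : nat) (a : 'I_n).
Implicit Types (p l h c : parent_map n) (A B : {set 'I_n}) (r u v w x : 'I_n).

(** In a forest the search always succeeds, so the default [a] is never returned ([tree_rootP]). *)
Definition tree_root p :=
  odflt a [pick r | connect (child_of p) a r && (p r == None)].

Definition tree_of p := [set x | connect (child_of p) x (tree_root p)].

Lemma tree_rootP p : is_forest p ->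
  connect (child_of p) a (tree_root p) /\ p (tree_root p) = None.
Proof.
move=> Fp; rewrite /tree_root; case: pickP => [r /andP[ar /eqP pr] //|none].
by have [r ar pr] := forest_root a Fp; move: (none r); rewrite ar pr.
Qed.

Definition larger B r x := [set u in B | x < u <= r].

(** Listing the allowed values at each vertex makes the decreasing trees a [family], whose cardinal
    is a product. *)
Definition parents_below B r x : {pred option 'I_n} :=
  [pred o | if x \in [set x in B | x < r]
            then o \in [set Some u | u in larger B r x] else o == None].

(* The trees on the labels of [B] up to [r] that decrease away from the root  *)
(* [r]; acyclicity is automatic.                                              *)
Definition decreasing B r : {set parent_map n} :=
  [set l in family (parents_below B r)].

Lemma decreasingP B r l :
  reflect (forall x, if (x \in B) && (x < r)
                     then exists2 u, l x = Some u & [/\ u \in B, x < u & u <= r]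
                     else l x = None)
          (l \in decreasing B r).
Proof.
rewrite inE; apply: (iffP familyP) => Hl x; move: (Hl x); rewrite !inE.
  case: ifP => [_ /imsetP[u]|_ /eqP //].
  by rewrite inE => /and3P[? ? ?] ->; exists u.
case: ifP => [_ [u -> [? ? ?]]|_ -> //].
by apply/imsetP; exists u; rewrite // inE; apply/and3P.
Qed.

(** The components of [t] are the parts below the root, above the root and outside the tree. The
    roots of the upper part become children of [r]. *)
Definition glue B r (t : parent_map n * parent_map n * parent_map n) :
    parent_map n :=
  [ffun x => if x \in B then
               if x < r then t.1.1 x
               else if r < x then (if t.1.2 x is Some u then Some u else Some r)
               else None
             else t.2 x].

(** No edge crosses the boundary of [B]. Below [r] labels increase towards [r], so chains there are
    monotone; above [r] a chain either lies in [h] or has [r] as its top and smallest label. Neither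
    creates a valley or a 231. *)
Lemma glue_in A B r l h c : B \subset A -> a \in B -> r \in B ->
  l \in decreasing B r -> h \in forests_on [set x in B | r < x] ->
  c \in forests_on (A :\: B) ->
  [/\ glue B r (l, h, c) \in forests_on A, tree_root (glue B r (l, h, c)) = r
    & tree_of (glue B r (l, h, c)) = B].
Proof.
move=> sBA aB rB /decreasingP Dl /forests_onP[Fh Sh Ch] /forests_onP[Fc Sc Cc].
set p := glue B r (l, h, c).
have pC x : x \notin B -> p x = c x by rewrite ffunE => /negbTE->.
have pr : p r = None by rewrite ffunE rB ltnn.
have pL x : x \in B -> x < r ->
    exists2 u, p x = Some u & [/\ u \in B, x < u & u <= r].
  by move=> xB xr; move: (Dl x); rewrite ffunE xB xr.
have pH x : x \in B -> r < x -> p x = if h x is Some u then Some u else Some r.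
  by move=> xB rx; rewrite ffunE xB rx ltnNge ltnW.
have clC x u : p x = Some u -> x \in ~: B -> u \in ~: B.
  rewrite !inE => pxu xB; move: pxu; rewrite pC // => /Sc[_].
  by rewrite inE => /andP[].
have clB x u : p x = Some u -> x \in B -> u \in B.
  move=> pxu xB; case: (ltngtP x r) => [xr|rx|/val_inj xr].
  - by have [y] := pL x xB xr; rewrite pxu => -[<-] [].
  - move: pxu; rewrite pH //; case hx: (h x) => [y|] [<-] //.
    by have [_] := Sh _ _ hx; rewrite inE => /andP[].
  - by rewrite xr pr in pxu.
have clA x u : p x = Some u -> x \in A /\ u \in A.
  move=> pxu; have [xB|xB] := boolP (x \in B).
    by split; apply: (subsetP sBA); rewrite // (clB _ _ pxu).
  by move: pxu; rewrite pC // => /Sc[]; rewrite !inE => /andP[_ ->] /andP[_ ->].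
have ancC v u : anc p v u -> v \notin B -> u \notin B /\ anc c v u.
  elim/anc_ind => {v u} [v u pv vB|v u w pv _ IH vB].
    have := clC _ _ pv; rewrite !inE => /(_ vB) uB; split=> //.
    by apply/ancP; exists u; [rewrite -pC | apply: connect0].
  have := clC _ _ pv; rewrite !inE => /(_ vB) /IH[wB uw]; split=> //.
  by apply/ancP; exists u; [rewrite -pC | rewrite connect_anc uw orbT].
have ancr u : ~~ anc p r u by apply/ancP; rewrite pr => -[].
have ancL v u : anc p v u -> v \in B -> v < r -> [/\ u \in B, v < u & u <= r].
  elim/anc_ind => {v u} [v u pv vB vr|v u w pv uw IH vB vr].
    by have [y] := pL v vB vr; rewrite pv => -[<-].
  have [y] := pL v vB vr; rewrite pv => -[<-] [uB vu].
  rewrite leq_eqVlt => /orP[/eqP/val_inj ur|ur].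
    by rewrite ur (negbTE (ancr _)) in uw.
  by have [wB uw' wr] := IH uB ur; split=> //; apply: ltn_trans uw'.
have ancH v u : anc p v u -> v \in B -> r < v ->
    u = r \/ [/\ u \in B, r < u & anc h v u].
  elim/anc_ind => {v u} [v u|v u w] pv.
    move=> vB rv; move: pv; rewrite pH //.
    case hv: (h v) => [y|] [<-]; last by left.
    have [_] := Sh _ _ hv; rewrite inE => /andP[yB ry]; right; split=> //.
    by apply/ancP; exists y => //; apply: connect0.
  move=> uw IH vB rv; move: pv; rewrite pH //.
  case hv: (h v) => [y|] [yu]; subst u.
    have [_] := Sh _ _ hv; rewrite inE => /andP[yB ry].
    have [->|[wB rw yw]] := IH yB ry; [by left|right; split=> //].
    by apply/ancP; exists y; rewrite // connect_anc yw orbT.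
  by rewrite (negbTE (ancr _)) in uw.
have Sp : p \in forests_on A.
  apply/forests_onP; split=> // [v|v u w vu uw].
    apply/negP => vv; have [vB|vB] := boolP (v \in B); last first.
      by have [_ vvc] := ancC _ _ vv vB; rewrite (negbTE (Fc _)) in vvc.
    case: (ltngtP v r) => [vr|rv|/val_inj vr].
    - by have [_] := ancL _ _ vv vB vr; rewrite ltnn.
    - have [vr|[_ _]] := ancH _ _ vv vB rv; last by rewrite (negbTE (Fh _)).
      by rewrite vr ltnn in rv.
    - by rewrite vr (negbTE (ancr _)) in vv.
  have [vB|vB] := boolP (v \in B); last first.
    have [uB vu'] := ancC _ _ vu vB; have [_ uw'] := ancC _ _ uw uB.
    exact: Cc vu' uw'.
  case: (ltngtP v r) => [vr|rv|/val_inj vr]; last first.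
  - by rewrite vr (negbTE (ancr _)) in vu.
  - have [ur|[uB ru vu']] := ancH _ _ vu vB rv.
      by rewrite ur (negbTE (ancr _)) in uw.
    have [wr|[wB rw uw']] := ancH _ _ uw uB ru; last exact: Ch vu' uw'.
    by rewrite /bad_chain wr; lia.
  - have [uB ltvu] := ancL _ _ vu vB vr.
    rewrite leq_eqVlt => /orP[/eqP/val_inj ur|ur].
      by rewrite ur (negbTE (ancr _)) in uw.
    by have [_ ltuw _] := ancL _ _ uw uB ur; rewrite /bad_chain; lia.
have Fp : is_forest p by move: Sp; rewrite inE => /and3P[].
(* Every vertex of [B] other than [r] has a parent, so [r] is the only root that can be reached
   inside [B]. *)
have rootB x y : x \in B -> connect (child_of p) x y -> p y = None -> y = r.
  move=> xB xy py; have yB := connect_stable clB xy xB.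
  case: (ltngtP y r) => [yr|ry|/val_inj //].
    by have [u] := pL y yB yr; rewrite py.
  by move: (pH y yB ry); rewrite py; case: (h y).
have root_r : tree_root p = r.
  by have [ar pr'] := tree_rootP Fp; apply: rootB ar pr'.
split=> //; apply/setP => x; rewrite inE root_r.
have [xB|xB] := boolP (x \in B).
  by have [y xy py] := forest_root x Fp; rewrite -(rootB x y).
apply/negP => xr; have := connect_stable clC xr.
by rewrite !inE xB rB => /(_ isT).
Qed.

(** The only possible confusion is between [h x = None] and [h x = Some r], which glue alike; the
    latter cannot occur because [r] is not in the support of [h]. *)
Lemma glue_inj B C r :
  {in setX (setX (decreasing B r) (forests_on [set x in B | r < x]))
           (forests_on (C :\: B)) &, injective (glue B r)}.
Proof.
move=> [[l h] c] [[l' h'] c'] /= /setXP[/setXP[/= Dl Sh] /= Sc].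
case/setXP=> [/setXP[/= Dl' Sh'] /= Sc'] eq_g.
have Eg x := congr1 (fun g : parent_map n => g x) eq_g.
have no_self h0 : h0 \in forests_on [set x in B | r < x] ->
    forall x, (h0 x != Some r) /\ (~~ ((x \in B) && (r < x)) -> h0 x = None).
  case/forests_onP=> _ S0 _ x; split.
    by apply/eqP => /S0[_]; rewrite inE ltnn andbF.
  case h0x: (h0 x) => [y|//]; have [] := S0 _ _ h0x.
  by rewrite inE => ->.
have offC c0 : c0 \in forests_on (C :\: B) -> forall x, x \in B -> c0 x = None.
  case/forests_onP=> _ S0 _ x xB; case c0x: (c0 x) => [y|//].
  by have [] := S0 _ _ c0x; rewrite inE xB.
congr (_, _, _); apply/ffunP => x; move: (Eg x); rewrite !ffunE /=.
- move: (decreasingP _ _ _ Dl x) (decreasingP _ _ _ Dl' x).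
  by case: (x \in B) => /=; case: (x < r) => //= -> ->.
- have [nr off] := no_self _ Sh x; have [nr' off'] := no_self _ Sh' x.
  case xB: (x \in B) off off' => /= off off'; last by rewrite off // off'.
  case: (ltngtP r x) off off' => //= rx off off'; try by rewrite off // off'.
  case: (h x) nr {off} => [y|]; case: (h' x) nr' {off'} => [y'|] //.
    by move=> _ nr [yr]; rewrite yr eqxx in nr.
  by move=> nr _ [yr]; rewrite -yr eqxx in nr.
- by case: ifP => // xB _; rewrite (offC _ Sc) // (offC _ Sc').
Qed.

(** The three pieces are restrictions of [p]. Avoidance along the chain from [r] through the parent
    of [x] to [x] keeps the parent on the same side of [r] as [x], unless it is [r] itself. *)
Lemma glue_onto A B r p : a \in A ->
  p \in forests_on A -> tree_root p = r -> tree_of p = B ->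
  exists l h c, [/\ l \in decreasing B r, h \in forests_on [set x in B | r < x],
                    c \in forests_on (A :\: B) & p = glue B r (l, h, c)].
Proof.
move=> aA Sp root_p tree_p; have /forests_onP[Fp sA Cp] := Sp.
have forest_p : is_forest p by apply/is_forestP.
have [_ pr] := tree_rootP forest_p; rewrite root_p in pr.
have inB x : (x \in B) = (x == r) || anc p x r.
  by rewrite -tree_p inE root_p connect_anc.
have parB x u : p x = Some u -> (x \in B) = (u \in B).
  move=> px; rewrite -tree_p !inE root_p; apply/idP/idP => [|ur].
    rewrite connect_anc => /orP[/eqP xr|/ancP[y]]; first by rewrite xr pr in px.
    by rewrite px => -[<-].
  by apply: connect_trans ur; apply/connect1/eqP.
have stepB x : x \in B -> x != r -> exists2 u, p x = Some u &
    u = r \/ [/\ u \in B, anc p u r, ~~ bad_chain r u x & u != x].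
  rewrite inB => /orP[->//|/ancP[u px ur] _]; exists u => //.
  move: ur; rewrite connect_anc => /orP[/eqP|ur]; [by left|right; split=> //].
  - by rewrite inB ur orbT.
  - by apply: Cp ur; apply/ancP; exists u.
  - apply/eqP=> ux; move: (Fp x); rewrite -{2}ux => /ancP[].
    by exists u.
have neq x : x < r -> x != r by rewrite neq_ltn => ->.
have neq' x : r < x -> x != r by rewrite neq_ltn orbC => ->.
exists [ffun x => if (x \in B) && (x < r) then p x else None].
(* The edges to [r] are cut, so that the children of [r] above it become roots. *)
exists [ffun x => if [&& x \in B, r < x & p x != Some r] then p x else None].
exists [ffun x => if x \in B then None else p x]; split.
- apply/decreasingP => x; rewrite ffunE; case: andP => [[xB xr]|//].
  have [u px [ur|[uB ur bad ux]]] := stepB x xB (neq x xr); exists u => //.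
    by rewrite ur inB eqxx.
  have : u != r by apply: contraNneq (Fp r) => ur'; rewrite -{1}ur'.
  move: bad ux; rewrite /bad_chain -!(inj_eq val_inj) /= => bad ux ur'.
  by split=> //; lia.
- apply: sub_forests_on Sp => x y; rewrite ffunE; case: ifP => //.
  move=> /and3P[xB rx xr] px; rewrite !inE xB rx -(parB _ _ px) xB /=.
  have [u] := stepB x xB (neq' x rx); rewrite px => -[<-] [yr|[_ ur bad ux]].
    by rewrite px yr eqxx in xr.
  have : y != r by apply: contraNneq (Fp r) => ur'; rewrite -{1}ur'.
  move: bad ux; rewrite /bad_chain -!(inj_eq val_inj) /= => bad ux ur'.
  by split=> //; lia.
- apply: sub_forests_on Sp => x y; rewrite ffunE; case: ifP => // xB px.
  by rewrite !inE -(parB _ _ px) xB /=; apply: sA px.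
- apply/ffunP => x; rewrite !ffunE /=; case xB: (x \in B) => //=.
  case: (ltngtP x r) => //= [rx|/ord_inj-> //].
  have [u px _] := stepB x xB (neq' x rx); rewrite px.
  by case: eqP => //= ->.
Qed.

Lemma card_fiber A B r : B \subset A -> a \in B -> r \in B ->
  #|[set p in forests_on A | (tree_of p == B) && (tree_root p == r)]| =
  #|decreasing B r| * #|forests_on [set x in B | r < x]|
    * #|forests_on (A :\: B)|.
Proof.
move=> sBA aB rB; rewrite -!cardsX -(card_in_imset (@glue_inj B A r)).
apply: eq_card => p; rewrite inE; apply/and3P/imsetP.
  case=> Sp /eqP tp /eqP rp.
  have [l [h [c [Dl Sh Sc ->]]]] := glue_onto (subsetP sBA _ aB) Sp rp tp.
  by exists (l, h, c); rewrite // !in_setX /= Dl Sh Sc.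
case=> -[[l h] c] /setXP[/setXP[/= Dl Sh] /= Sc] ->.
by have [-> -> ->] := glue_in sBA aB rB Dl Sh Sc.
Qed.

End Decomposition.

(** * Counting the pieces and summing *)

(** The number of larger elements takes each value below [#|B|] exactly once. The induction removes
    the minimum, which has the most elements above it and is never counted for the others. *)
Lemma big_ord_rank (R : Type) (idx : R) (op : Monoid.com_law idx) n
    (B : {set 'I_n}) (f : nat -> R) :
  \big[op/idx]_(x in B) f #|[set u in B | x < u]| =
  \big[op/idx]_(i < #|B|) f i.
Proof.
have [m] := ubnP #|B|; elim: m B => // m IHm B; rewrite ltnS => le_Bm.
have [->|[y yB]] := set_0Vmem B; first by rewrite big_set0 cards0 big_ord0.
case: (@arg_minnP _ y (mem B) (@nat_of_ord n) yB) => {y yB} x /= xB minx.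
have cB := cardsD1 x B; rewrite xB add1n in cB.
rewrite cB big_ord_recr /= Monoid.mulmC (big_setD1 x xB); congr (op _ _) => /=.
  congr f; apply: eq_card => u; rewrite !inE ltn_neqAle.
  rewrite andbC eq_sym (inj_eq val_inj) -andbA; congr (_ && _).
  by case uB: (u \in B); rewrite ?andbF // minx.
rewrite -IHm; last by rewrite -cB.
apply: eq_bigr => u; rewrite !inE => /andP[ux uB].
congr f; apply: eq_card => v; rewrite !inE.
case: (v =P x) => [->|//]; apply/andP => -[_].
by rewrite ltnNge minx.
Qed.

Lemma sum_card_subset (T : finType) (D : {set T}) (g : nat -> nat) :
  \sum_(B : {set T} | B \subset D) g #|B| =
  \sum_(k < #|D|.+1) 'C(#|D|, k) * g k.
Proof.
rewrite (partition_big (fun B : {set T} => inord #|B| : 'I_#|D|.+1) xpredT) //=.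
apply: eq_bigr => k _; rewrite -cards_draws -sum_nat_const.
have eq_k (B : {set T}) :
    B \subset D -> (inord #|B| == k :> 'I_#|D|.+1) = (#|B| == k).
  by move=> sBD; rewrite -val_eqE /= inordK // ltnS subset_leq_card.
apply: eq_big => [B|B /andP[sBD]]; last by rewrite eq_k // => /eqP->.
by rewrite inE; case sBD: (B \subset D); rewrite //= eq_k.
Qed.

Lemma card_decreasing n (B : {set 'I_n}) r : r \in B ->
  #|decreasing B r| = #|[set x in B | x < r]|`!.
Proof.
move=> rB; set L := [set x in B | x < r].
rewrite cardsE card_family foldrE big_image /= (bigID (mem L)) /=.
rewrite [X in _ * X]big1 ?muln1 => [|x]; last first.
  rewrite !inE => /negbTE xL; rewrite -(card1 (None : option 'I_n)).
  by apply: eq_card => o; rewrite !inE xL.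
rewrite (eq_bigr (fun x : 'I_n => #|[set u in L | x < u]|.+1)) =>
    [|x xL]; last first.
  transitivity #|larger B r x|.
    rewrite -(card_imset _ (@Some_inj _)); apply: eq_card => o.
    by move: xL; rewrite !inE => ->.
  (* Besides the larger labels of [L], the root [r] is one more possible parent: hence the
     successor. *)
  have rL : r \notin [set u in L | x < u] by rewrite !inE ltnn andbF.
  have <- : #|r |: [set u in L | x < u]| = #|[set u in L | x < u]|.+1.
    by rewrite cardsU1 rL.
  apply: eq_card => u; rewrite !inE.
  have [->|ur] := eqVneq u r.
    by move: xL; rewrite inE rB leqnn => /andP[_ ->].
  rewrite [u <= r]leq_eqVlt (inj_eq val_inj) (negbTE ur) /=.
  by rewrite -andbA [(x < u) && _]andbC.
by rewrite (big_ord_rank _ _ succn) fact_prod big_add1 big_mkord.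
Qed.

Lemma card_forests_on_rec n (A : {set 'I_n}) a : a \in A ->
  #|forests_on A| = \sum_(B : {set 'I_n} | (B \subset A) && (a \in B))
    \sum_(r in B) #|[set x in B | x < r]|`! *
      #|forests_on [set x in B | r < x]| * #|forests_on (A :\: B)|.
Proof.
move=> aA.
have root_forest p : p \in forests_on A ->
    connect (child_of p) a (tree_root a p) /\ p (tree_root a p) = None.
  by rewrite inE => /and3P[Fp _ _]; apply: tree_rootP.
rewrite -sum1_card
  (partition_big (tree_of a) (fun B => (B \subset A) && (a \in B))) /=.
  apply: eq_bigr => B /andP[sBA aB].
  rewrite (partition_big (tree_root a) (mem B)) /= => [|p]; last first.
    by case/andP=> _ /eqP <-; rewrite inE connect0.
  apply: eq_bigr => r rB; rewrite -card_decreasing // -(card_fiber sBA aB rB).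
  by rewrite -sum1dep_card; apply: eq_bigl => p; rewrite andbA.
move=> p Sp; have [ar pr] := root_forest p Sp; rewrite inE ar andbT.
apply/subsetP=> x; rewrite inE connect_anc => /orP[/eqP->|]; last first.
  by case/ancP=> u; case/forests_onP: Sp => _ sA _ /sA[].
apply: (connect_stable (X := mem A)) ar aA => v u.
by case/forests_onP: Sp => _ sA _ /sA[].
Qed.

(** An abstract [g] is required to give the count on smaller label sets only, so the recursion can
    serve inside the induction that identifies [g] with [F]. *)
Lemma card_forests_on_step n (A : {set 'I_n}) (g : nat -> nat) : 0 < #|A| ->
  (forall B : {set 'I_n}, #|B| < #|A| -> #|forests_on B| = g #|B|) ->
  #|forests_on A| = \sum_(1 <= k < #|A|.+1) \sum_(1 <= r < k.+1)
    'C(#|A|.-1, k.-1) * (r.-1)`! * g (#|A| - k) * g (k - r).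
Proof.
move=> A_gt0 IH; have /card_gt0P[a aA] := A_gt0.
have cA : #|A :\ a| = #|A|.-1 by rewrite (cardsD1 a A) aA.
pose h k := g (#|A| - k) * \sum_(1 <= r < k.+1) (r.-1)`! * g (k - r).
transitivity (\sum_(B : {set 'I_n} | (B \subset A) && (a \in B)) h #|B|).
  rewrite (card_forests_on_rec aA); apply: eq_bigr => B /andP[sBA aB].
  (* The sum over r ranks the root from below, while [big_ord_rank] indexes it by the number of
     labels of [B] above it: the sum is reversed to match. *)
  rewrite /h mulnC big_distrl /= big_add1 /= big_rev_mkord subn0.
  rewrite -(big_ord_rank _ B (fun i =>
    (#|B| - i.+1)`! * g (#|B| - (#|B| - i.+1).+1) * g (#|A| - #|B|))) /=.
  apply: eq_bigr => r rB.
  have cB : #|[set x in B | x < r]| + #|[set x in B | r < x]|.+1 = #|B|.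
    rewrite addnS -add1n (cardsD1 r B) rB; congr (_ + _).
    rewrite -(cardsID [set x : 'I_n | x < r] (B :\ r)).
    congr (_ + _); apply: eq_card => x;
      rewrite !inE -(inj_eq val_inj) /= neq_ltn.
      by case: ltngtP; rewrite ?andbF ?andbT.
    by case: ltngtP; rewrite ?andbF ?andbT.
  have leBA := subset_leq_card sBA.
  rewrite (IH [set x in B | r < x]); last by lia.
  rewrite IH cardsDS //; last by lia.
  by congr (_`! * g _ * g _); rewrite -cB addnK // addnS subSS addKn.
(* Removing [a] from [B] leaves an arbitrary subset of [A :\ a], which is the source of the shifted
   binomial. *)
rewrite (reindex_onto (fun B => a |: B) (fun B => B :\ a)) /=; last first.
  by move=> B /andP[_ aB]; rewrite setD1K.
transitivity (\sum_(B : {set 'I_n} | B \subset A :\ a) h #|B|.+1).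
  apply: eq_big => B.
    rewrite subUset sub1set aA setU11 andbT subsetD1 /=; congr (_ && _).
    apply/eqP/idP => [<-|aB]; [by rewrite !inE eqxx | exact: setU1K].
  by case/andP=> _ /eqP eqB; rewrite cardsU1 -eqB !inE eqxx eqB.
rewrite (sum_card_subset _ (fun k => h k.+1)) cA prednK // big_add1 big_mkord.
apply: eq_bigr => k _; rewrite /h mulnA big_distrr /=.
by apply: eq_bigr => r _; rewrite -!mulnA; congr (_ * _); rewrite mulnCA.
Qed.

(** The set [A] and the full label set of size [#|A|] obey the same recursion; the induction
    quantifies over [n] to cover both ambient types. *)
Lemma card_forests_on n (A : {set 'I_n}) : #|forests_on A| = F #|A|.
Proof.
have [m] := ubnP #|A|; elim: m n A => // m IHm n A; rewrite ltnS => le_Am.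
have [A0|A_gt0] := posnP #|A|.
  by rewrite A0 (cards0_eq A0) forests_on0.
have cT : #|[set: 'I_#|A|]| = #|A| by rewrite cardsT card_ord.
(* Both cardinals unfold to the same sum; only the hypotheses on smaller sets remain. *)
rewrite F_forests_on !(@card_forests_on_step _ _ F) ?cT //.
- by move=> B ltB; apply: IHm; apply: leq_trans le_Am.
- by move=> B ltB; apply: IHm; apply: leq_trans le_Am.
Qed.

Theorem theorem5p9 :
  (forall n : nat, 1 <= n ->
    F n = \sum_(1 <= k < n.+1) \sum_(1 <= r < k.+1)
            'C(n.-1, k.-1) * (r.-1)`! * F (n - k) * F (k - r)) /\
  F 1 = 1.
Proof.
have rec n : 1 <= n ->
    F n = \sum_(1 <= k < n.+1) \sum_(1 <= r < k.+1)
            'C(n.-1, k.-1) * (r.-1)`! * F (n - k) * F (k - r).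
  move=> n_gt0; have cT : #|[set: 'I_n]| = n by rewrite cardsT card_ord.
  rewrite F_forests_on (@card_forests_on_step _ _ F) ?cT // => B _.
  exact: card_forests_on.
(* At n = 1 the recursion has the single term C(0,0) 0! [F 0] [F 0]. *)
by split=> //; rewrite rec // !big_nat1.
Qed.
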